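(* Let $n,p\in\mathbb{N}$, $A\in\mathbb{R}^{p\times n}$, $\ell,u\in\mathbb{R}^p$ with $\ell\leq u$ (componentwise), $\rho>0$, $\alpha>0$, $x\in\mathbb{R}^n$ and $\mu\in\mathbb{R}^p$. Consider the quadratic program in the variables $(z,\xi)\in\mathbb{R}^p\times\mathbb{R}^p$ $$ \min_{z,\xi}\ \ \frac{1}{2}\begin{bmatrix}z\\ \xi\end{bmatrix}^\top\begin{bmatrix}\rho I&0\\0&\alpha I\end{bmatrix}\begin{bmatrix}z\\ \xi\end{bmatrix}+\begin{bmatrix}-\rho Ax-\mu\\0\end{bmatrix}^\top\begin{bmatrix}z\\ \xi\end{bmatrix}\quad\text{s.t.}\quad \ell\leq z+\xi\leq u . $$ Then the solution $(z,\xi)$ to this quadratic program satisfies $$ z=\widetilde{\mathrm{Proj}}_{[\ell,u]}\left(Ax+\mu/\rho\right), $$ where $\widetilde{\mathrm{Proj}}_{[\ell,u]}$ is the smoothed projection operator with parameters $\rho,\alpha$.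
   Context: All vector inequalities are componentwise, and $I$ denotes the $p\times p$ identity matrix. For $\rho>0$, $\alpha>0$ and $\ell\leq u$ in $\mathbb{R}^p$, the smoothed projection operator $\widetilde{\mathrm{Proj}}_{[\ell,u]}:\mathbb{R}^p\to\mathbb{R}^p$ is defined elementwise: for $\tilde z\in\mathbb{R}^p$ and $i=1,\dots,p$, $$ \left(\widetilde{\mathrm{Proj}}_{[\ell,u]}(\tilde z)\right)_i=\begin{cases}\tilde z_i&\text{if }\ell_i\leq\tilde z_i\leq u_i,\\[1mm] \dfrac{\rho\tilde z_i+\alpha\ell_i}{\rho+\alpha}&\text{if }\tilde z_i<\ell_i,\\[2mm] \dfrac{\rho\tilde z_i+\alpha u_i}{\rho+\alpha}&\text{if }\tilde z_i>u_i.\end{cases} $$ *)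

(* Defs.v *)
From mathcomp Require Import all_boot all_order all_algebra.

Set Implicit Arguments.
Unset Strict Implicit.
Unset Printing Implicit Defensive.

Import Order.TTheory GRing.Theory Num.Theory.
Local Open Scope ring_scope.

Definition vec_le (R : realFieldType) (p : nat) (v w : 'cV[R]_p) : Prop :=
  forall i : 'I_p, v i ord0 <= w i ord0.

(* The last branch is the case [u i < z i]: the two earlier tests exclude
   every other possibility. *)
Definition smoothed_proj (R : realFieldType) (p : nat) (rho alpha : R)
    (l u z : 'cV[R]_p) : 'cV[R]_p :=
  \col_(i < p)
    (if l i ord0 <= z i ord0 <= u i ord0 then z i ord0
     else if z i ord0 < l i ord0 then
       (rho * z i ord0 + alpha * l i ord0) / (rho + alpha)
     else (rho * z i ord0 + alpha * u i ord0) / (rho + alpha)).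

(* The decision variable [y : 'cV_(p + p)] stacks z over xi. Both summands
   are 1 x 1 matrices, whence the final [ord0 ord0]. *)
Definition qp_objective (R : realFieldType) (n p : nat) (rho alpha : R)
    (A : 'M[R]_(p, n)) (x : 'cV[R]_n) (mu : 'cV[R]_p)
    (y : 'cV[R]_(p + p)) : R :=
  (2^-1 *: (y^T *m block_mx (rho *: 1%:M) 0 0 (alpha *: 1%:M) *m y)
   + (col_mx (- (rho *: (A *m x)) - mu) (0 : 'cV[R]_p))^T *m y) ord0 ord0.

Definition qp_feasible (R : realFieldType) (p : nat) (l u : 'cV[R]_p)
    (y : 'cV[R]_(p + p)) : Prop :=
  vec_le l (usubmx y + dsubmx y) /\ vec_le (usubmx y + dsubmx y) u.

Definition qp_solution (R : realFieldType) (n p : nat) (rho alpha : R)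
    (A : 'M[R]_(p, n)) (l u : 'cV[R]_p) (x : 'cV[R]_n) (mu : 'cV[R]_p)
    (y : 'cV[R]_(p + p)) : Prop :=
  qp_feasible l u y /\
  (forall y' : 'cV[R]_(p + p), qp_feasible l u y' ->
     qp_objective rho alpha A x mu y <= qp_objective rho alpha A x mu y').

(* Main.v *)
(** The objective separates into the coordinate problems of minimising
    [rho/2 z^2 - rho t z + alpha/2 xi^2] subject to [l <= z + xi <= u], with [t] a
    coordinate of [A x + mu / rho]. Let [w] be the projection of [t] on [[l, u]]. The
    minimiser splits the residual [w - t] in the ratio [alpha : rho], that is,
    [z = t + alpha (w - t) / (rho + alpha)] and [xi = rho (w - t) / (rho + alpha)],
    so that [z + xi = w] and both partial derivatives equal
    [lambda = rho alpha (w - t) / (rho + alpha)]. The first-order term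
    [lambda (v - w)] is nonnegative for every [v] in [[l, u]], and strong convexity
    then gives both optimality and uniqueness. *)
Require Import Defs.
From mathcomp Require Import all_boot all_order all_algebra.
From mathcomp Require Import ring lra.

Set Implicit Arguments.
Unset Strict Implicit.
Unset Printing Implicit Defensive.

Import Order.TTheory GRing.Theory Num.Theory.
Local Open Scope ring_scope.

(** The exact projection on [[l, u]], with the branch tests of [smoothed_proj] so that the case
    splits match. *)
Definition clamp (R : realFieldType) (l u t : R) : R :=
  if l <= t <= u then t else if t < l then l else u.

Lemma clamp_bounds (R : realFieldType) (l u t : R) :
  l <= u -> l <= clamp l u t <= u.
Proof.
rewrite /clamp => lu; case: ifP => // _.
by case: ifP => _; rewrite lexx lu.
Qed.

(** The residual vanishes inside the interval; outside, it points from [t] inward, as does any move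
    from the active endpoint to [v]. *)
Lemma clamp_variational (R : realFieldType) (l u t v : R) :
  l <= v <= u -> 0 <= (clamp l u t - t) * (v - clamp l u t).
Proof.
case/andP=> lv vu; rewrite /clamp.
case: (lerP l t) => lt /=; last by apply: mulr_ge0; lra.
case: (lerP t u) => tu; first by rewrite subrr mul0r.
by apply: mulr_le0; lra.
Qed.

(** All branches are the mean of [t] and its clamp with weights [rho] and [alpha]; inside, the two
    coincide. *)
Lemma smoothed_projE (R : realFieldType) (p : nat) (rho alpha : R)
    (l u t : 'cV[R]_p) (i : 'I_p) :
  rho + alpha != 0 ->
  smoothed_proj rho alpha l u t i ord0 =
  t i ord0 + alpha / (rho + alpha) *
    (clamp (l i ord0) (u i ord0) (t i ord0) - t i ord0).
Proof.
move=> nz; rewrite mxE /clamp.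
case: ifP => _; first by rewrite subrr mulr0 addr0.
by case: ifP => _; field.
Qed.

Lemma coordinate_growth (R : realFieldType) (rho alpha l u t z xi : R) :
  0 < rho -> 0 < alpha -> l <= z + xi <= u ->
  let w := clamp l u t in
  let z0 := t + alpha / (rho + alpha) * (w - t) in
  let xi0 := w - z0 in
  (2^-1 * (rho * z0 ^+ 2 + alpha * xi0 ^+ 2) - rho * t * z0) +
    2^-1 * (rho * (z - z0) ^+ 2 + alpha * (xi - xi0) ^+ 2) <=
  2^-1 * (rho * z ^+ 2 + alpha * xi ^+ 2) - rho * t * z.
Proof.
move=> rho0 alpha0 zxi /=; set w := clamp l u t.
set z0 := t + alpha / (rho + alpha) * (w - t); set xi0 := w - z0.
have nz : rho + alpha != 0 by rewrite gt_eqF // addr_gt0.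
rewrite -subr_ge0.
(* Second-order expansion at [(z0, xi0)] is exact, so only the first-order term remains. *)
have -> : 2^-1 * (rho * z ^+ 2 + alpha * xi ^+ 2) - rho * t * z -
    (2^-1 * (rho * z0 ^+ 2 + alpha * xi0 ^+ 2) - rho * t * z0 +
     2^-1 * (rho * (z - z0) ^+ 2 + alpha * (xi - xi0) ^+ 2)) =
    rho * alpha / (rho + alpha) * ((w - t) * (z + xi - w)).
  by rewrite /xi0 /z0; field.
apply: mulr_ge0; last exact: clamp_variational.
by rewrite divr_ge0 ?mulr_ge0 ?addr_ge0 // ltW.
Qed.

(** Since [rho] is invertible, the linear coefficient [- rho A x - mu] equals [- rho t]. *)
Lemma qp_objectiveE (R : realFieldType) (n p : nat) (rho alpha : R)
    (A : 'M[R]_(p, n)) (x : 'cV[R]_n) (mu z xi : 'cV[R]_p) :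
  rho != 0 ->
  let t := A *m x + rho^-1 *: mu in
  qp_objective rho alpha A x mu (col_mx z xi) =
  \sum_i (2^-1 * (rho * z i ord0 ^+ 2 + alpha * xi i ord0 ^+ 2) -
          rho * t i ord0 * z i ord0).
Proof.
move=> rho0 t; rewrite /qp_objective.
rewrite !tr_col_mx mul_row_block !mulmx0 addr0 add0r !mul_row_col.
rewrite trmx0 mul0mx addr0 -!scalemxAr !mulmx1.
rewrite !mxE -big_split mulr_sumr -big_split; apply: eq_bigr => i _ /=.
by rewrite /t !mxE; field.
Qed.

Section Minimiser.

Variables (R : realFieldType) (n p : nat) (A : 'M[R]_(p, n)) (l u : 'cV[R]_p).
Variables (rho alpha : R) (x : 'cV[R]_n) (mu : 'cV[R]_p).
Hypotheses (l_le_u : vec_le l u) (rho_gt0 : 0 < rho) (alpha_gt0 : 0 < alpha).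

Let t : 'cV[R]_p := A *m x + rho^-1 *: mu.
Let z0 : 'cV[R]_p := smoothed_proj rho alpha l u t.
Let xi0 : 'cV[R]_p :=
  \col_i (clamp (l i ord0) (u i ord0) (t i ord0) - z0 i ord0).

Lemma qp_minimiser_feasible : qp_feasible l u (col_mx z0 xi0).
Proof.
split=> i; rewrite col_mxKu col_mxKd [(z0 + xi0) i ord0]mxE
  [xi0 i ord0]mxE addrC subrK;
by have /andP[] := clamp_bounds (t i ord0) (l_le_u i).
Qed.

Lemma qp_growth (z xi : 'cV[R]_p) :
  qp_feasible l u (col_mx z xi) ->
  qp_objective rho alpha A x mu (col_mx z0 xi0) +
    \sum_i 2^-1 * (rho * (z i ord0 - z0 i ord0) ^+ 2 +
                   alpha * (xi i ord0 - xi0 i ord0) ^+ 2) <=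
  qp_objective rho alpha A x mu (col_mx z xi).
Proof.
rewrite /qp_feasible col_mxKu col_mxKd => -[lzx zxu].
have nz : rho + alpha != 0 by rewrite gt_eqF // addr_gt0.
rewrite !qp_objectiveE ?gt_eqF // -big_split; apply: ler_sum => i _ /=.
rewrite [xi0 i ord0]mxE [z0 i ord0]smoothed_projE //.
apply: coordinate_growth => //.
by move: (lzx i) (zxu i); rewrite !mxE => -> ->.
Qed.

Let growth_term_ge0 (a b : R) : 0 <= 2^-1 * (rho * a ^+ 2 + alpha * b ^+ 2).
Proof.
by rewrite mulr_ge0 ?invr_ge0 ?ler0n // addr_ge0 // mulr_ge0 ?sqr_ge0 // ltW.
Qed.

Lemma qp_minimiser_solution :
  qp_solution rho alpha A l u x mu (col_mx z0 xi0).
Proof.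
split; first exact: qp_minimiser_feasible.
move=> y; rewrite -[y]vsubmxK => /qp_growth; apply: le_trans.
by rewrite lerDl sumr_ge0.
Qed.

Lemma qp_solution_unique (y : 'cV[R]_(p + p)) :
  qp_solution rho alpha A l u x mu y -> y = col_mx z0 xi0.
Proof.
rewrite -[y]vsubmxK; move: (usubmx y) (dsubmx y) => z xi [feas opt].
(* Growth at [y], combined with optimality of [y] against the explicit minimiser, leaves no room for
   a positive gap. *)
have := le_trans (qp_growth feas) (opt _ qp_minimiser_feasible).
rewrite gerDl => sum_le0.
have /eqP : \sum_i 2^-1 * (rho * (z i ord0 - z0 i ord0) ^+ 2 +
    alpha * (xi i ord0 - xi0 i ord0) ^+ 2) = 0.
  by apply/le_anti; rewrite sum_le0 sumr_ge0.
rewrite psumr_eq0 // => /allP term0.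
have eqs i : z i ord0 = z0 i ord0 /\ xi i ord0 = xi0 i ord0.
  have := term0 i (mem_index_enum i).
  rewrite /= mulf_eq0 invr_eq0 pnatr_eq0 /=.
  rewrite paddr_eq0 ?(pmulr_rge0 _ rho_gt0) ?(pmulr_rge0 _ alpha_gt0) ?sqr_ge0 //.
  rewrite !mulf_eq0 (gt_eqF rho_gt0) (gt_eqF alpha_gt0) /= !orbb !subr_eq0.
  by case/andP => /eqP -> /eqP ->.
by congr col_mx; apply/matrixP => i j; rewrite ord1; case: (eqs i).
Qed.

End Minimiser.

(** The first conjunct justifies speaking of the solution and keeps the second from being
    vacuous. *)
Theorem lemma1 (R : realFieldType) (n p : nat) (A : 'M[R]_(p, n))
    (l u : 'cV[R]_p) (l_le_u : vec_le l u)
    (rho alpha : R) (rho_gt0 : 0 < rho) (alpha_gt0 : 0 < alpha)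
    (x : 'cV[R]_n) (mu : 'cV[R]_p) :
  (exists! y : 'cV[R]_(p + p), qp_solution rho alpha A l u x mu y) /\
  (forall z xi : 'cV[R]_p,
     qp_solution rho alpha A l u x mu (col_mx z xi) ->
     z = smoothed_proj rho alpha l u (A *m x + rho^-1 *: mu)).
Proof.
split.
  eexists; split; first exact: qp_minimiser_solution.
  by move=> y /(qp_solution_unique l_le_u rho_gt0 alpha_gt0).
by move=> z xi /(qp_solution_unique l_le_u rho_gt0 alpha_gt0) /eq_col_mx[].
Qed.
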